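(* Let $S$ be a numerical set whose complement $\widetilde{S}$ is a numerical semigroup. Then $A(S)$ has at most one small atom. Moreover, if $S$ is not a numerical semigroup, then $A(S)$ has at most one small element.
   Context: $\mathbb{N}=\{0,1,2,\dots\}$. A numerical set is a subset $S\subseteq\mathbb{N}$ with $0\in S$ and $\mathbb{N}\setminus S$ finite. Its gaps are the elements of $\mathbb{N}\setminus S$, and $F(S)$ is the largest gap, with $F(\mathbb{N})=-1$. A numerical semigroup is a numerical set closed under addition. The associated semigroup of $S$ is $A(S)=\{s\in S\mid s+S\subseteq S\}$; it is a numerical semigroup with $F(A(S))=F(S)$. For a numerical semigroup $T$: - an atom is a positive element of $T$ not expressible as a sum of two positive elements of $T$; - a small atom is an atom smaller than $F(T)$; - a small element is a positive element of $T$ smaller than $F(T)$. For $S\neq\mathbb{N}$, the base is $B(S)=\max\{s\in S\mid s<F(S)\}$. Young diagram of $S$: it has one left-justified row for each gap $\ell$. The top row corresponds to $F(S)$, and the gaps decrease going down. The row for $\ell$ has length $|\{s\in S\mid s<\ell\}|$. This is a bijection between numerical sets and Young diagrams, with $\mathbb{N}$ corresponding to the empty diagram. The complement of a Young diagram with rows $\lambda_1\ge\dots\ge\lambda_g$ has rows $\lambda_1-\lambda_g\ge\dots\ge\lambda_1-\lambda_1$, zero rows being discarded. Geometrically, this is the rest of the $g\times\lambda_1$ rectangle rotated by $180^\circ$. The complement $\widetilde{S}$ is the numerical set whose Young diagram is the complement of that of $S$. One has $\widetilde{\mathbb{N}}=\mathbb{N}$, and for $S\neq\mathbb{N}$ equivalently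 $\widetilde{S}=\{B(S)-s\mid s\in S,\ s\le B(S)\}\cup\{n\mid n\ge B(S)\}$. *)

(* Defs.v *)
From HB Require Import structures.
From mathcomp Require Import all_boot all_order all_algebra finmap.
From mathcomp Require Import all_classical.

Set Implicit Arguments.
Unset Strict Implicit.
Unset Printing Implicit Defensive.

Import Order.TTheory GRing.Theory Num.Theory.

Local Open Scope classical_set_scope.
Local Open Scope nat_scope.

Definition numerical_set (S : set nat) : Prop :=
  S 0 /\ finite_set (~` S).

Definition numerical_semigroup (T : set nat) : Prop :=
  numerical_set T /\ (forall s t : nat, T s -> T t -> T (s + t)).

(* [fset_set] is the empty set on infinite sets, so the three definitions     *)
(* below are only meaningful when the complement of S is finite.              *)
Definition gaps (S : set nat) : seq nat := sort geq (fset_set (~` S)).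

Definition frobenius (S : set nat) : int :=
  (\big[Order.max/(-1)]_(l <- gaps S) l%:Z)%R.

Definition young_diagram (S : set nat) : seq nat :=
  [seq #|` fset_set (S `&` [set s | s < l])| | l <- gaps S].

Definition diagram_complement (la : seq nat) : seq nat :=
  [seq r <- [seq head 0 la - r | r <- rev la] | r != 0].

(* Numerical sets correspond bijectively to Young diagrams, so there is       *)
(* exactly one such T for each numerical set S.                               *)
Definition is_complement (S T : set nat) : Prop :=
  numerical_set T /\ young_diagram T = diagram_complement (young_diagram S).

Definition associated_semigroup (S : set nat) : set nat :=
  [set s | S s /\ forall t : nat, S t -> S (s + t)].

Definition atoms (T : set nat) : set nat :=
  [set a | [/\ T a, 0 < a
             & ~ exists s t : nat, [/\ T s, 0 < s, T t, 0 < t & a = s + t]]].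

Definition small_atoms (T : set nat) : set nat :=
  [set a | atoms T a /\ (a%:Z < frobenius T)%R].

Definition small_elements (T : set nat) : set nat :=
  [set t | [/\ T t, 0 < t & (t%:Z < frobenius T)%R]].

(* Main.v *)
(* Let F be the largest gap of S and B the base. The complement being a
   semigroup means that s + t - B lies in S whenever s, t <= B are in S and
   s + t >= B. Let a be a small element of A(S). Then the set of residues mod a
   of elements of S below B is closed under subtracting B, hence also under
   adding B, and S contains every number with such a residue. Thus, for small
   a < b in A(S), also b - a is in A(S), so b is not an atom. Moreover, a or
   b - a is then a small element c of A(S) with 2c <= B; representing residues
   mod c in the window (B - c, B] shows that they are closed under addition,
   so that S is a semigroup. *)
Require Import Defs.
From HB Require Import structures.
From mathcomp Require Import all_boot all_order all_algebra finmap.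
From mathcomp Require Import all_classical.
From mathcomp Require Import zify.

Set Implicit Arguments.
Unset Strict Implicit.
Unset Printing Implicit Defensive.

Import Order.TTheory.

Local Open Scope nat_scope.

(** * Young diagrams determine numerical sets *)

Lemma mem_gaps (S : set nat) (n : nat) :
  numerical_set S -> (n \in gaps S) = ~~ `[< S n >].
Proof.
move=> [_ fS]; rewrite /gaps mem_sort in_fset_set // -asbool_neg.
by apply/idP/asboolP; rewrite inE.
Qed.

Lemma gaps_sorted (S : set nat) : sorted gtn (gaps S).
Proof.
rewrite gtn_sorted_uniq_geq sort_uniq fset_uniq /=.
by apply: sort_sorted => m n; exact: leq_total.
Qed.

Lemma gtn_sorted_eq (s t : seq nat) :
  sorted gtn s -> sorted gtn t -> s =i t -> s = t.
Proof.
apply: irr_sorted_eq; first by move=> y x z /= xy yz; exact: ltn_trans yz xy.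
by move=> x /=; rewrite ltnn.
Qed.

Lemma young_diagramE (S : set nat) :
  young_diagram S =
    [seq count (fun n => `[< S n >]) (iota 0 l) | l <- gaps S].
Proof.
apply: eq_map => l; rewrite -size_filter; apply/perm_size/uniq_perm.
- exact: fset_uniq.
- by rewrite filter_uniq // iota_uniq.
move=> n; rewrite in_fset_set; last first.
  by apply: (@sub_finite_set _ _ `I_l) => [k []|]; [|exact: finite_II].
rewrite mem_filter mem_iota /= add0n.
apply/idP/andP; rewrite inE.
  by move=> [Sn nl]; split=> //; apply/asboolP.
by move=> [/asboolP].
Qed.

Lemma count_ltn_nth (s : seq nat) (i : nat) :
  sorted gtn s -> i < size s ->
  count (fun x => x < nth 0 s i) s = size s - i.+1.
Proof.
elim: s i => [|l s IHs] [|i] //= ss lti.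
  rewrite ltnn add0n subn1; apply/eqP; rewrite -all_count.
  by apply: order_path_min ss => y x z /= xy yz; exact: ltn_trans yz xy.
have /allP lb : all (gtn l) s.
  by apply: order_path_min ss => y x z /= xy yz; exact: ltn_trans yz xy.
rewrite ltnNge (ltnW (lb _ (mem_nth 0 _))) //= add0n subSS IHs //.
exact: path_sorted ss.
Qed.

(** The [l] numbers below a gap [l] are the elements of [S] below it, counted by its row, and the
    smaller gaps, counted by its position in the decreasing list. *)
Lemma nth_gaps (S : set nat) (i : nat) :
  numerical_set S -> i < size (gaps S) ->
  nth 0 (gaps S) i = nth 0 (young_diagram S) i + (size (gaps S) - i.+1).
Proof.
move=> nS lti; rewrite young_diagramE (nth_map 0) //.
rewrite -count_ltn_nth ?gaps_sorted //; set l := nth 0 _ i.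
rewrite -[LHS](size_iota 0) -(count_predC (fun n => `[< S n >])).
congr (_ + _); rewrite -!size_filter; apply/perm_size/uniq_perm.
- by rewrite filter_uniq // iota_uniq.
- by rewrite filter_uniq // sort_uniq fset_uniq.
by move=> n; rewrite !mem_filter mem_iota /= add0n mem_gaps // andbC.
Qed.

(** The number of rows is the number of gaps, and [nth_gaps] then recovers each gap. *)
Lemma young_diagram_inj (S T : set nat) :
  numerical_set S -> numerical_set T ->
  young_diagram S = young_diagram T -> S = T.
Proof.
move=> nS nT eST.
have esz : size (gaps S) = size (gaps T).
  by have := congr1 size eST; rewrite !size_map.
have eg : gaps S = gaps T.
  apply: (@eq_from_nth _ 0) => // i lti.
  by rewrite !nth_gaps ?eST ?esz // -esz.
apply/seteqP; split=> n /asboolP.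
  by rewrite -[asbool _]negbK -mem_gaps // eg mem_gaps // negbK => /asboolP.
by rewrite -[asbool _]negbK -mem_gaps // -eg mem_gaps // negbK => /asboolP.
Qed.

(** The reflection [n |-> b - n] carries [[0, m)] onto [(b - m, b]]. *)
Lemma count_iota_rev (p : pred nat) (b m : nat) :
  m <= b -> count (fun n => p (b - n)) (iota 0 m) = count p (iota (b - m).+1 m).
Proof.
elim: m => // m IHm ltmb.
rewrite -[in LHS]addn1 iotaD count_cat IHm; last exact: ltnW.
by rewrite add0n subnSK //= addn0 addnC.
Qed.

(** * Base, explicit complement and reflection *)

(* [F] and [B] are characterised rather than computed: [F] is the largest gap
   of [S] and [B] the largest element of [S] below it. *)
Definition frobenius_base (S : set nat) (F B : nat) : Prop :=
  [/\ ~ S F, forall n, F < n -> S n, S B, B < F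
    & forall n, B < n -> S n -> F < n].

Lemma frobenius_base_exists (S : set nat) (l : nat) :
  numerical_set S -> ~ S l -> exists F B, frobenius_base S F B.
Proof.
move=> nS nSl.
have exF : exists n, n \in gaps S.
  by exists l; rewrite mem_gaps //; apply/asboolP.
have ubF n : n \in gaps S -> n <= \max_(i <- gaps S) i.
  by move=> gn; exact: leq_bigmax_seq.
case: (ex_maxnP exF ubF) => F; rewrite mem_gaps // => /asboolP nSF maxF.
have SF n : F < n -> S n.
  move=> ltFn; apply: contrapT => /asboolP; rewrite asbool_neg -mem_gaps //.
  by move=> /maxF; rewrite leqNgt ltFn.
have F0 : 0 < F by rewrite lt0n; apply/eqP => F0; apply: nSF; rewrite F0; case: nS.
have exB : exists n, `[< S n >] && (n < F).
  by exists 0; rewrite F0 andbT; apply/asboolP; case: nS.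
have ubB n : `[< S n >] && (n < F) -> n <= F by case/andP => _ /ltnW.
case: (ex_maxnP exB ubB) => B /andP[/asboolP SB ltBF] maxB.
exists F, B; split=> // n ltBn Sn; rewrite ltnNge leq_eqVlt.
apply/negP => /orP[/eqP e|ltnF]; first by apply: nSF; rewrite -e.
by have := maxB n; rewrite ltnF andbT leqNgt ltBn => /(_ (introT (asboolP _) Sn)).
Qed.

(** The reflections [B - s] of the elements [s <= B] of [S], together with all [n >= B], which
    satisfy the implication vacuously. *)
Definition explicit_complement (S : set nat) (B : nat) : set nat :=
  [set n | n < B -> S (B - n)]%classic.

Lemma numerical_set_explicit_complement (S : set nat) (B : nat) :
  S B -> numerical_set (explicit_complement S B).
Proof.
move=> SB; split; first by rewrite /explicit_complement /= subn0.
apply: (@sub_finite_set _ _ `I_B); last exact: finite_II.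
move=> n /= nT; rewrite ltnNge; apply/negP => leBn; apply: nT.
by rewrite /explicit_complement /= ltnNge leBn.
Qed.

(* Reflection reverses the order, so the decreasing list of gaps of the
   complement comes from the increasing list of gaps of [S]. *)
Lemma gaps_explicit_complement (S : set nat) (B : nat) :
  numerical_set S -> S B ->
  gaps (explicit_complement S B) =
    [seq B - l | l <- [seq l <- rev (gaps S) | l < B]].
Proof.
move=> nS SB; apply: gtn_sorted_eq; first exact: gaps_sorted.
  have lts : sorted ltn [seq l <- rev (gaps S) | l < B].
    apply: sorted_filter; first exact: ltn_trans.
    by rewrite rev_sorted; exact: gaps_sorted.
  apply: (homo_sorted_in (P := [pred l | l < B])) lts; last exact: filter_all.
  by move=> m n; rewrite !inE /= => ltmB ltnB ltmn; exact: ltn_sub2l.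
move=> n; rewrite mem_gaps; last exact: numerical_set_explicit_complement.
apply/asboolPn/mapP => [nT|[l]].
  have ltnB : n < B by rewrite ltnNge; apply/negP => leBn; apply: nT => ltnB; lia.
  exists (B - n); last lia.
  have nSBn : ~ S (B - n) by move=> SBn; apply: nT.
  rewrite mem_filter mem_rev mem_gaps //; apply/andP; split; last exact/asboolPn.
  suff n0 : n != 0 by lia.
  by apply: contra_not_neq nSBn => ->; rewrite subn0.
rewrite mem_filter mem_rev mem_gaps // => /andP[ltlB /asboolPn nSl] ->.
have l0 : l != 0 by apply: contra_not_neq nSl => ->; case: nS.
by rewrite /explicit_complement /= subKn ?(ltnW ltlB) // => /(_ ltac:(lia)).
Qed.

Lemma gaps_head (S : set nat) (F B : nat) :
  numerical_set S -> frobenius_base S F B -> head 0 (gaps S) = F.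
Proof.
move=> nS [nSF SF _ _ _].
have : F \in gaps S by rewrite mem_gaps //; exact/asboolPn.
have /= : forall l, l \in gaps S -> l <= F.
  move=> l; rewrite mem_gaps // => /asboolPn nSl.
  by rewrite leqNgt; apply/negP => /SF.
have := gaps_sorted S; case: (gaps S) => //= l s sls leF; rewrite inE.
case/predU1P => // Fs.
have /allP/(_ _ Fs) : all (gtn l) s.
  by apply: order_path_min sls => y x z /= xy yz; exact: ltn_trans yz xy.
by move=> /=; have := leF l; rewrite inE eqxx => /(_ isT); lia.
Qed.

(** Subtracting the row of a gap [l] from the longest row, that of [F], leaves the number of
    elements of [S] in [(l, B]]. Reflection turns these into the elements of the complement below
    its gap [B - l]. *)
Lemma young_diagram_explicit_complement (S : set nat) (F B : nat) :
  numerical_set S -> frobenius_base S F B ->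
  young_diagram (explicit_complement S B) =
    diagram_complement (young_diagram S).
Proof.
move=> nS hFB; have [nSF SF SB ltBF SBF] := hFB.
set p := fun n => `[< S n >]; pose f l := count p (iota 0 l).
have hf : head 0 (young_diagram S) = f F.
  rewrite young_diagramE -(gaps_head nS hFB).
  have : F \in gaps S by rewrite mem_gaps //; exact/asboolPn.
  by case: (gaps S).
rewrite /diagram_complement hf [young_diagram S]young_diagramE -map_rev -map_comp.
rewrite filter_map young_diagramE gaps_explicit_complement // -map_comp.
have fF l : ~ S l -> l <= F -> f F - f l = count p (iota l.+1 (B - l)).
  move=> nSl lelF.
  rewrite /f -[in iota 0 F](subnKC lelF) iotaD count_cat add0n addKn.
  case: (leqP l B) => [lelB|ltBl].
    (* [[l, F)] splits into the gap [l], the interval [(l, B]], and the numbers strictly between [B]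
       and [F], none of which is in [S]. *)
    have -> : F - l = (B - l).+1 + (F - B).-1 by lia.
    rewrite iotaD count_cat /= (_ : p l = false) ?add0n; last exact/asboolPn.
    rewrite [X in _ + X](_ : _ = 0) ?addn0 //.
    apply/eqP; rewrite -leqn0 leqNgt -has_count; apply/hasPn => n.
    rewrite mem_iota => ?; apply/asboolPn => /SBF; lia.
  have -> : B - l = 0 by lia.
  apply/eqP; rewrite -leqn0 leqNgt -has_count; apply/hasPn => n.
  by rewrite mem_iota => ?; apply/asboolPn => /SBF; lia.
have gapP l : l \in rev (gaps S) -> ~ S l /\ l <= F.
  rewrite mem_rev mem_gaps // => /asboolPn nSl; split=> //.
  by rewrite leqNgt; apply/negP => /SF.
(* The discarded zero rows come from the gaps above [B]; for [l < B] the difference counts at least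
   [B] itself. *)
have -> : [seq l <- rev (gaps S) | preim ((fun r => f F - r) \o f) (predC1 0) l]
    = [seq l <- rev (gaps S) | l < B].
  apply: eq_in_filter => l /gapP[nSl lelF] /=; rewrite fF //.
  rewrite -lt0n -has_count; apply/hasP/idP => [[n]|ltlB].
    by rewrite mem_iota; lia.
  by exists B; [rewrite mem_iota; lia|exact/asboolP].
apply/eq_in_map => l; rewrite mem_filter => /andP[ltlB /gapP[nSl lelF]] /=.
rewrite fF //; have := count_iota_rev p (leq_subr l B).
rewrite subKn 1?ltnW // => <-.
apply: eq_in_count => n; rewrite mem_iota => ?; apply: asbool_equiv_eq.
by rewrite /explicit_complement /=; split=> [|//]; apply; lia.
Qed.

(* Closure of the complement under addition, transported to [S] by the
   reflection [s |-> B - s]. *)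
Definition reflected_closed (S : set nat) (B : nat) : Prop :=
  forall s t, S s -> S t -> s <= B -> t <= B -> B <= s + t -> S (s + t - B).

Lemma complement_reflected_closed (S T : set nat) (F B : nat) :
  numerical_set S -> is_complement S T -> numerical_semigroup T ->
  frobenius_base S F B -> reflected_closed S B.
Proof.
move=> nS [nT yT] [_ addT] hFB; have [_ _ SB _ _] := hFB.
have eT : T = explicit_complement S B.
  apply: young_diagram_inj => //; first exact: numerical_set_explicit_complement.
  by rewrite yT (young_diagram_explicit_complement nS hFB).
move=> s t Ss St lesB letB leBst.
have Ts : T (B - s) by rewrite eT /explicit_complement /= subKn.
have Tt : T (B - t) by rewrite eT /explicit_complement /= subKn.
have := addT _ _ Ts Tt; rewrite eT /explicit_complement /= => TT.
(* If [s + t = B], the reflected sum is [B], where membership in the complement says nothing about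
   [S]; here [S 0] is used. *)
have [e|ne] := eqVneq (s + t) B; first by rewrite e subnn; case: nS.
have -> : s + t - B = B - (B - s + (B - t)) by lia.
by apply: TT; lia.
Qed.

(** * Residues modulo a small element of A(S) *)

Definition residue (S : set nat) (B a x : nat) : Prop :=
  exists s, [/\ S s, s <= B & s = x %[mod a]].

Lemma associated_addM (S : set nat) (a s k : nat) :
  associated_semigroup S a -> S s -> S (s + k * a).
Proof.
by move=> [_ Aa] Ss; elim: k => [|k IHk]; rewrite ?addn0 // mulSn addnCA; exact: Aa.
Qed.

Lemma associated_small_le (S : set nat) (F B a : nat) :
  frobenius_base S F B -> associated_semigroup S a -> a < F -> a <= B.
Proof.
by move=> [_ _ _ _ SBF] [Sa _] ltaF; rewrite leqNgt; apply/negP => /SBF/(_ Sa); lia.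
Qed.

Lemma mem_residue (S : set nat) (B a x : nat) : S x -> x <= B -> residue S B a x.
Proof. by move=> Sx lexB; exists x. Qed.

Lemma eq_residue (S : set nat) (B a x y : nat) :
  x = y %[mod a] -> residue S B a x -> residue S B a y.
Proof. by move=> exy [s [Ss lesB es]]; exists s; split=> //; rewrite es. Qed.

(* Move [s] up by multiples of [a] into the window (B - a, B], where adding [a]
   and reflecting lands in [1, a]. *)
Lemma residue_subB (S : set nat) (B a x : nat) :
  reflected_closed S B -> associated_semigroup S a -> 0 < a <= B ->
  residue S B a x ->
  exists s, [/\ S s, 0 < s <= a & s + B = x %[mod a]].
Proof.
move=> PS Aa /andP[a0 leaB] [s [Ss lesB es]].
have ek := divn_eq (B - s) a; have lta := ltn_pmod (B - s) a0.
set k := (B - s) %/ a in ek; set r := (_ %% _) in ek lta.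
exists (s + k * a + a - B); split; last 1 first.
- by rewrite subnK; [rewrite modnDr addnC modnMDl|lia].
- apply: PS; [exact: associated_addM|by case: Aa|lia..].
lia.
Qed.

(** The representative given by [residue_subB] is at most [a <= B], so the step can be iterated. *)
Lemma residue_subnB (S : set nat) (B a x k : nat) :
  reflected_closed S B -> associated_semigroup S a -> 0 < a <= B ->
  residue S B a (x + k * B) -> residue S B a x.
Proof.
move=> PS Aa aB; elim: k => [|k IHk]; rewrite ?addn0 // mulSnr addnA.
move=> /(residue_subB PS Aa aB)[s [Ss sa /eqP]].
rewrite eqn_modDr => /eqP es; apply: IHk; exists s; split=> //; lia.
Qed.

(** Modulo [a], adding [B] amounts to subtracting it [a - 1] times. *)
Lemma residue_addB (S : set nat) (B a x : nat) :
  reflected_closed S B -> associated_semigroup S a -> 0 < a <= B ->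
  residue S B a x -> residue S B a (x + B).
Proof.
move=> PS Aa aB Rx; apply: (residue_subnB (k := a.-1) PS Aa aB).
apply: eq_residue Rx; rewrite -addnA -mulSn prednK; last by case/andP: aB.
by rewrite mulnC addnC modnMDl.
Qed.

(** Adding [B] and subtracting it again yields a representative in [S] within [[1, a]]; a positive
    [x] is reached from it by adding multiples of [a]. *)
Lemma residue_mem (S : set nat) (B a x : nat) :
  S 0 -> reflected_closed S B -> associated_semigroup S a -> 0 < a <= B ->
  residue S B a x -> S x.
Proof.
move=> S0 PS Aa aB Rx; have [->//|x0] := posnP x.
have [s [Ss sa /eqP]] := residue_subB PS Aa aB (residue_addB PS Aa aB Rx).
rewrite eqn_modDr => /eqP es.
have lesx : s <= x.
  rewrite leqNgt; apply/negP => ltxs; have ltxa : x < a by lia.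
  move: es; rewrite (modn_small ltxa).
  have [ltsa|leas] := ltnP s a; first by rewrite modn_small //; lia.
  by rewrite (_ : s = a) ?modnn; lia.
have /eqP/divnK e : (x - s) %% a = 0.
  by apply/eqP; rewrite -/(dvdn a (x - s)) -eqn_mod_dvd // es.
by rewrite -(subnKC lesx) -e; exact: associated_addM.
Qed.

(** * Consequences for small elements of A(S) *)

Lemma small_sub (S : set nat) (F B a b : nat) :
  numerical_set S -> frobenius_base S F B -> reflected_closed S B ->
  associated_semigroup S a -> associated_semigroup S b ->
  0 < a -> a < b -> b < F -> associated_semigroup S (b - a).
Proof.
move=> [S0 _] hFB PS Aa Ab a0 ltab ltbF; have [_ SF SB _ SBF] := hFB.
have lebB := associated_small_le hFB Ab ltbF.
have aB : 0 < a <= B by lia.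
have [[Sa _] [Sb Abt]] := (Aa, Ab).
have sub_mem x : a <= x -> residue S B a x -> S (x - a).
  move=> leax Rx; apply: (residue_mem S0 PS Aa aB).
  by apply: eq_residue Rx; rewrite -[in LHS](subnK leax) modnDr.
split=> [|s Ss]; first by apply: sub_mem (ltnW ltab) _; exact: mem_residue.
have [ltBs|lesB] := ltnP B s; first by apply: SF; have := SBF _ ltBs Ss; lia.
rewrite addnC addnBA ?(ltnW ltab) //.
apply: sub_mem; first lia.
(* The class of [s + b] is a residue: either [s + b] is itself in [S] up to [B], or [s + b - B] is,
   and [B] is added back. *)
have [lesbB|ltBsb] := leqP (s + b) B.
  by apply: mem_residue lesbB; rewrite addnC; apply: Abt.
rewrite -(subnK (ltnW ltBsb)); apply: (residue_addB PS Aa aB).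
by apply: mem_residue; [apply: PS => //; lia|lia].
Qed.

Lemma semigroup_of_two_small (S : set nat) (F B a : nat) :
  numerical_set S -> frobenius_base S F B -> reflected_closed S B ->
  associated_semigroup S a -> 0 < a -> a + a <= B -> numerical_semigroup S.
Proof.
move=> nS hFB PS Aa a0 leaaB; have [S0 _] := nS; split=> // s t Ss St.
have [_ SF SB _ SBF] := hFB; have aB : 0 < a <= B by lia.
have [ltBs|lesB] := ltnP B s; first by apply: SF; have := SBF _ ltBs Ss; lia.
have [ltBt|letB] := ltnP B t; first by apply: SF; have := SBF _ ltBt St; lia.
have lift x : S x -> x <= B ->
    exists y, [/\ S y, B - a < y, y <= B & y = x %[mod a]].
  move=> Sx lexB; exists (x + (B - x) %/ a * a).
  have := divn_eq (B - x) a; have := ltn_pmod (B - x) a0.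
  split; [exact: associated_addM|lia|lia|by rewrite addnC modnMDl].
have [s' [Ss' lts' les' es']] := lift s Ss lesB.
have [t' [St' ltt' let' et']] := lift t St letB.
apply: (residue_mem S0 PS Aa aB).
apply: (@eq_residue _ _ _ (s' + t')); first by rewrite -modnDm es' et' modnDm.
(* Both summands exceed [B - a], so [a + a <= B] makes the sum large enough to reflect. *)
have leB : B <= s' + t' by lia.
rewrite -(subnK leB); apply: (residue_addB PS Aa aB).
by apply: mem_residue; [exact: PS|lia].
Qed.

Lemma lt_frobenius_gap (A : set nat) (n : nat) :
  (n%:Z < frobenius A)%R -> exists2 l, n < l & ~ A l.
Proof.
move=> ltnA; apply: contrapT => nogap; move: ltnA; apply/negP; rewrite -leNgt.
rewrite /frobenius big_seq; apply: bigmax_le => // l.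
rewrite mem_sort => lA.
(* [fset_set] is empty on infinite sets, so the entry [l] forces finiteness. *)
have fA : finite_set (~` A)%classic.
  by move: lA; rewrite /fset_set; case: pselect.
have {lA} nAl : ~ A l by move: lA; rewrite (in_fset_set fA) inE.
by rewrite lez_nat leqNgt; apply/negP => ltnl; apply: nogap; exists l.
Qed.

(** All numbers above [F] lie in A(S), so no gap of A(S) exceeds [F]. *)
Lemma associated_small_lt (S : set nat) (F B a : nat) :
  frobenius_base S F B -> (a%:Z < frobenius (associated_semigroup S))%R ->
  a < F.
Proof.
move=> [_ SF _ _ _] /lt_frobenius_gap[l ltal nAl]; apply: (leq_trans ltal).
rewrite leqNgt; apply/negP => ltFl; apply: nAl; split=> [|t _]; apply: SF => //.
exact: ltn_addr.
Qed.

Theorem theorem4p1 (S T : set nat)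
    (hS : numerical_set S)
    (hST : is_complement S T)
    (hT : numerical_semigroup T) :
  is_subset1 (small_atoms (associated_semigroup S)) /\
  (~ numerical_semigroup S ->
     is_subset1 (small_elements (associated_semigroup S))).
Proof.
set A := associated_semigroup S.
(* If [S] has no gap, neither has A(S), and nothing is small. *)
have [[l nSl]|allS] := pselect (exists l, ~ S l); last first.
  have nosmall a : ~ (a%:Z < frobenius A)%R.
    move=> /lt_frobenius_gap[l _]; apply.
    have {}allS n : S n by apply: contrapT => nSn; apply: allS; exists n.
    by split.
  by split=> [a b [_ /nosmall]|_ a b [_ _ /nosmall]].
have [F [B hFB]] := frobenius_base_exists hS nSl.
have PS := complement_reflected_closed hS hST hT hFB.
have subA a b : A a -> A b -> 0 < a -> a < b ->
    (b%:Z < frobenius A)%R -> A (b - a).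
  move=> Aa Ab a0 ltab /(associated_small_lt hFB).
  exact: small_sub hFB PS Aa Ab a0 ltab.
have wlog_lt (P : set nat) :
    (forall a b, P a -> P b -> a < b -> False) -> is_subset1 P.
  move=> noP a b Pa Pb; case: (ltngtP a b) => // [ltab|ltba].
    by case: (noP _ _ Pa Pb ltab).
  by case: (noP _ _ Pb Pa ltba).
split=> [|nsS]; apply: wlog_lt => a b.
  move=> [[Aa a0 _] _] [[Ab _ atb] smb] ltab; apply: atb.
  exists a, (b - a); split=> //; [exact: subA|by rewrite subn_gt0|].
  by rewrite subnKC // ltnW.
move=> [Aa a0 _] [Ab b0 smb] ltab; apply: nsS.
have Aba := subA _ _ Aa Ab a0 ltab smb.
have lebB := associated_small_le hFB Ab (associated_small_lt hFB smb).
(* If [b < 2a], then [2(b - a) < b]; so twice [a] or twice [b - a] is at most [b <= B]. *)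
have [le_a|lt_ba] := leqP (a + a) b.
  apply: (semigroup_of_two_small hS hFB PS Aa a0); lia.
by apply: (semigroup_of_two_small hS hFB PS Aba); lia.
Qed.
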